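(* Let $T:\mathbf{L}^2\to\mathbf{L}$ be a t$_{lor}$-norm on $\mathbf{L}$. Then $T$ is a t$_{r}$-norm on $\mathbf{L}$.
   Context: Let $I=[0,1]$ and let $\mathbf{M}$ be the set of all maps $I\to I$; $\wedge,\vee$ denote minimum and maximum of real numbers. A function $f\in\mathbf{M}$ is normal if $\sup\{f(x)\mid x\in I\}=1$, and convex if $f(y)\ge f(x)\wedge f(z)$ whenever $0\le x\le y\le z\le 1$. $\mathbf{L}$ is the set of all normal and convex $f\in\mathbf{M}$. For $B\subseteq I$, $\bm{1}_B\in\mathbf{M}$ is the characteristic function of $B$. Let $\mathbf{J}=\{\bm{1}_{\{x\}}\mid x\in I\}$ and $\mathbf{K}=\{\bm{1}_{[a,b]}\mid 0\le a\le b\le 1\}$. For $f,g\in\mathbf{M}$ define $(f\sqcap g)(x)=\sup\{f(y)\wedge g(z)\mid y\wedge z=x\}$ and $(f\sqcup g)(x)=\sup\{f(y)\wedge g(z)\mid y\vee z=x\}$, and write $f\sqsubseteq g$ if $f\sqcap g=f$ (this is a partial order on $\mathbf{M}$, and $\mathbf{L}$ is closed under $\sqcap$ and $\sqcup$). Consider the following axioms for a binary operation $T:\mathbf{L}^2\to\mathbf{L}$: (O1) $T(f,g)=T(g,f)$ for all $f,g\in\mathbf{L}$; (O2) $T(T(f,g),h)=T(f,T(g,h))$ for all $f,g,h\in\mathbf{L}$; (O3) $T(f,\bm{1}_{\{1\}})=f$ for all $f\in\mathbf{L}$; (O4) for $f,g,h\in\mathbf{L}$ with $f\sqsubseteq g$,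 $T(f,h)\sqsubseteq T(g,h)$; (O4') $T(f,g\sqcup h)=T(f,g)\sqcup T(f,h)$ for all $f,g,h\in\mathbf{L}$; (O4'') $T(f,g\sqcap h)=T(f,g)\sqcap T(f,h)$ for all $f,g,h\in\mathbf{L}$; (O5) $T(\bm{1}_{[0,1]},\bm{1}_{[a,b]})=\bm{1}_{[0,b]}$ for all $0\le a\le b\le 1$; (O6) $T$ is closed on $\mathbf{J}$ (i.e. $T(\mathbf{J}^2)\subseteq\mathbf{J}$); (O7) $T$ is closed on $\mathbf{K}$ (i.e. $T(\mathbf{K}^2)\subseteq\mathbf{K}$). $T$ is a t$_{r}$-norm on $\mathbf{L}$ if it satisfies (O1), (O2), (O3), (O4), (O5), (O6), (O7). $T$ is a t$_{lor}$-norm (lattice-ordered t$_r$-norm) on $\mathbf{L}$ if it satisfies (O1), (O2), (O3), (O4'), (O4''), (O5), (O6), (O7). *)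

(* Defs.v *)
From mathcomp Require Import all_boot all_order all_algebra.
From mathcomp Require Import interval_inference.
From mathcomp Require Import all_classical all_reals.

Set Implicit Arguments.
Unset Strict Implicit.
Unset Printing Implicit Defensive.
Import Order.TTheory GRing.Theory Num.Theory.
Local Open Scope classical_set_scope.
Local Open Scope ring_scope.

Section TruthValues.
Variable R : realType.

Local Notation I := {i01 R}.

Definition zeroI : I := 0%:i01.
Definition oneI : I := 1%:i01.

(* Every subset of [0, 1] has a supremum, 0 being that of the empty set; see
   supI_supremums. *)
Definition supI (A : set I) : I := supremum zeroI A.

Definition M : Type := I -> I.

Definition chi (B : set I) : M := fun x => if x \in B then oneI else zeroI.

Definition normal (f : M) : Prop := supI (range f) = oneI.

Definition convex (f : M) : Prop :=
  forall x y z : I, x <= y -> y <= z -> Order.min (f x) (f z) <= f y.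

Definition meetM (f g : M) : M := fun x =>
  supI [set w | exists y z : I,
    Order.min y z = x /\ w = Order.min (f y) (g z)].

Definition joinM (f g : M) : M := fun x =>
  supI [set w | exists y z : I,
    Order.max y z = x /\ w = Order.min (f y) (g z)].

Definition leM (f g : M) : Prop := meetM f g = f.

Definition L : set M := [set f | normal f /\ convex f].

Lemma zeroI_le (x : I) : zeroI <= x.
Proof. by rewrite -[_ <= _]/(0 <= x%:num). Qed.

Lemma le_oneI (x : I) : x <= oneI.
Proof. by rewrite -[_ <= _]/(x%:num <= 1). Qed.

Lemma supI_supremums (A : set I) : supremums A (supI A).
Proof.
rewrite /supI /supremum; case: ifPn => [/eqP ->|/set0P A0].
  by split=> [x []|x _]; exact: zeroI_le.
suff [s As] : supremums A !=set0 by exact: (xgetPex zeroI (ex_intro _ s As)).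
pose B : set R := [set x%:num | x in A].
have Bub : has_ubound B by exists 1 => _ [x _ <-]; exact: (le_oneI x).
have B0 : B !=set0 by case: A0 => x Ax; exists x%:num, x.
have s0 : 0 <= sup B.
  case: A0 => x Ax; have x0 : 0 <= x%:num := zeroI_le x.
  by apply: (le_trans x0); apply: ub_le_sup => //; exists x.
have s1 : sup B <= 1.
  by apply: (ge_sup B0) => _ [x _ <-]; exact: (le_oneI x).
exists (Itv01 s0 s1 : I); split=> [x Ax|y Ay].
  by rewrite -[_ <= _]/(x%:num <= sup B); apply: ub_le_sup => //; exists x.
rewrite -[_ <= _]/(sup B <= y%:num); apply: (ge_sup B0) => _ [x Ax <-].
exact: (Ay x Ax).
Qed.

Lemma supI_ub (A : set I) x : A x -> x <= supI A.
Proof. by move: x; exact: (supI_supremums A).1. Qed.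

Lemma supI_le (A : set I) y : (forall x, A x -> x <= y) -> supI A <= y.
Proof. exact: (supI_supremums A).2. Qed.

Lemma supI_gt (A : set I) y : y < supI A -> exists2 x, A x & y < x.
Proof.
move=> yA; apply: contrapT => /forall2NP nA.
suff : supI A <= y by rewrite leNgt yA.
by apply: supI_le => x Ax; rewrite leNgt; apply/negP; case: (nA x).
Qed.

Lemma supI_one (A : set I) :
  (forall e, e < oneI -> exists2 x, A x & e < x) -> supI A = oneI.
Proof.
move=> H; apply/eqP; rewrite eq_le le_oneI leNgt; apply/negP => /H[x Ax].
by rewrite ltNge (supI_ub Ax).
Qed.

Lemma normal_gt (f : M) e : normal f -> e < oneI -> exists x, e < f x.
Proof. by move=> <- /supI_gt[_ [x _ <-]]; exists x. Qed.

Lemma meetM_L (f g : M) : L f -> L g -> L (meetM f g).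
Proof.
move=> [nf cf] [ng cg]; split.
  apply: supI_one => e e1.
  have [[y fy] [z gz]] := (normal_gt nf e1, normal_gt ng e1).
  exists (meetM f g (Order.min y z)); first by exists (Order.min y z).
  apply: (@lt_le_trans _ _ (Order.min (f y) (g z))); first by rewrite lt_min fy.
  by apply: supI_ub; exists y, z.
move=> a b c ab bc; rewrite leNgt; apply/negP.
rewrite lt_min => /andP[/supI_gt[_ [y1 [z1 [e1 ->]]] h1]].
move=> /supI_gt[_ [y2 [z2 [e2 ->]]] h2].
set s := meetM f g b in h1 h2.
have ub y z : Order.min y z = b -> s < f y -> s < g z -> False.
  move=> yz sf sg; have : s < Order.min (f y) (g z) by rewrite lt_min sf.
  by rewrite ltNge => /negP; apply; apply: supI_ub; exists y, z.
move: h1 h2; rewrite !lt_min => /andP[f1 g1] /andP[f2 g2].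
have cy : c <= y2 by rewrite -e2 ge_min lexx.
have cz : c <= z2 by rewrite -e2 ge_min lexx orbT.
have [by2 bz2] := (le_trans bc cy, le_trans bc cz).
case: (leP y1 z1) e1 => [_|_] e1.
  apply: (ub b z2) => //; first exact/min_idPl.
  by apply: (lt_le_trans _ (cf y1 b y2 _ by2)); rewrite ?lt_min ?f1 // e1.
apply: (ub y2 b) => //; first exact/min_idPr.
by apply: (lt_le_trans _ (cg z1 b z2 _ bz2)); rewrite ?lt_min ?g1 // e1.
Qed.

Lemma joinM_L (f g : M) : L f -> L g -> L (joinM f g).
Proof.
move=> [nf cf] [ng cg]; split.
  apply: supI_one => e e1.
  have [[y fy] [z gz]] := (normal_gt nf e1, normal_gt ng e1).
  exists (joinM f g (Order.max y z)); first by exists (Order.max y z).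
  apply: (@lt_le_trans _ _ (Order.min (f y) (g z))); first by rewrite lt_min fy.
  by apply: supI_ub; exists y, z.
move=> a b c ab bc; rewrite leNgt; apply/negP.
rewrite lt_min => /andP[/supI_gt[_ [y1 [z1 [e1 ->]]] h1]].
move=> /supI_gt[_ [y2 [z2 [e2 ->]]] h2].
set s := joinM f g b in h1 h2.
have ub y z : Order.max y z = b -> s < f y -> s < g z -> False.
  move=> yz sf sg; have : s < Order.min (f y) (g z) by rewrite lt_min sf.
  by rewrite ltNge => /negP; apply; apply: supI_ub; exists y, z.
move: h1 h2; rewrite !lt_min => /andP[f1 g1] /andP[f2 g2].
have ya : y1 <= a by rewrite -e1 le_max lexx.
have za : z1 <= a by rewrite -e1 le_max lexx orbT.
have [yb zb] := (le_trans ya ab, le_trans za ab).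
case: (leP y2 z2) e2 => [_|_] e2.
  apply: (ub y1 b) => //; first exact/max_idPr.
  by apply: (lt_le_trans _ (cg z1 b z2 zb _)); rewrite ?lt_min ?g1 // e2.
apply: (ub b z1) => //; first exact/max_idPl.
by apply: (lt_le_trans _ (cf y1 b y2 yb _)); rewrite ?lt_min ?f1 // e2.
Qed.

Lemma chi_itv_L (a b : I) : a <= b -> L (chi `[a, b]).
Proof.
move=> ab; split.
  apply: supI_one => e e1; exists oneI => //; exists a => //.
  by rewrite /chi mem_set //= in_itv /= lexx ab.
have E t : (t \in `[a, b]%classic) = (a <= t <= b).
  by apply/idP/idP; rewrite inE /= in_itv.
move=> x y z xy yz; rewrite /chi !E.
case: ifPn => [/andP[ax _]|_]; last by rewrite ge_min zeroI_le.
case: ifPn => [/andP[_ zb]|_]; last by rewrite ge_min zeroI_le orbT.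
by rewrite (le_trans ax xy) (le_trans yz zb) ge_min lexx.
Qed.

Lemma chi_set1_L (x : I) : L (chi [set x]).
Proof. by rewrite -set_itv1; exact: chi_itv_L. Qed.

Definition meetL (f g : L) : L :=
  exist _ (meetM (val f) (val g)) (mem_set (meetM_L (set_valP f) (set_valP g))).

Definition joinL (f g : L) : L :=
  exist _ (joinM (val f) (val g)) (mem_set (joinM_L (set_valP f) (set_valP g))).

Definition chi1L (x : I) : L := exist _ (chi [set x]) (mem_set (chi_set1_L x)).

Definition chi_itvL (a b : I) (ab : a <= b) : L :=
  exist _ (chi `[a, b]) (mem_set (chi_itv_L ab)).

Definition J : set L := [set f | exists x : I, val f = chi [set x]].

Definition K : set L :=
  [set f | exists a b : I, a <= b /\ val f = chi `[a, b]].

Definition closed_on (T : L -> L -> L) (A : set L) : Prop :=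
  forall f g : L, A f -> A g -> A (T f g).

Definition increasingL (T : L -> L -> L) : Prop :=
  forall f g h : L, leM (val f) (val g) -> leM (val (T f h)) (val (T g h)).

Definition boundary01 (T : L -> L -> L) : Prop :=
  forall (a b : I) (ab : a <= b),
    T (chi_itvL (zeroI_le oneI)) (chi_itvL ab) = chi_itvL (zeroI_le b).

Record tr_norm (T : L -> L -> L) : Prop := TrNorm {
  tr_comm : commutative T;
  tr_assoc : associative T;
  tr_unit : right_id (chi1L oneI) T;
  tr_increasing : increasingL T;
  tr_boundary : boundary01 T;
  tr_closedJ : closed_on T J;
  tr_closedK : closed_on T K }.

Record tlor_norm (T : L -> L -> L) : Prop := TlorNorm {
  tlor_comm : commutative T;
  tlor_assoc : associative T;
  tlor_unit : right_id (chi1L oneI) T;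
  tlor_join : right_distributive T joinL;
  tlor_meet : right_distributive T meetL;
  tlor_boundary : boundary01 T;
  tlor_closedJ : closed_on T J;
  tlor_closedK : closed_on T K }.

End TruthValues.

Arguments L R _ : clear implicits.

(* Main.v *)
Require Import Defs.
From mathcomp Require Import all_boot all_order all_algebra.
From mathcomp Require Import all_classical all_reals.

(** An operation that distributes over a meet is monotone for the order
    [f = meet f g] of that meet: applying [T _ h] to the equation gives
    [T f h = meet (T f h) (T g h)]. The two notions of norm differ only in
    distributivity versus monotonicity. *)

Theorem theorem2 (R : realType) (T : L R -> L R -> L R) :
  tlor_norm T -> tr_norm T.
Proof.
case=> TC TA T1 _ Tmeet Tb TJ TK; split=> // f g h le_fg.
have fgE : meetL f g = f by exact: val_inj.
suff Tfg : meetL (T f h) (T g h) = T f h by exact: (congr1 val Tfg).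
by rewrite ![T _ h]TC -Tmeet fgE.
Qed.
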